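(* Let $\mathcal F$ be any consistent numerical flux for the homogeneous Saint-Venant system, with associated consistent numerical entropy flux $\mathcal G$. The hydrostatic reconstruction scheme built on $\mathcal F$ does not satisfy the fully discrete entropy inequality without quadratic error term, however restrictive the CFL condition is. That is, for every $\kappa>0$ there exist discrete data $U_i=(h_i,h_iu_i)^T$ with $h_i\geq 0$, $z_i\in\mathbb R$ $(i\in\mathbb Z)$, $v_m\ge 0$ with $|u_i|+\sqrt{2gh_i}\le v_m$ for all $i$, and $\Delta t^n>0$, $\Delta x_i>0$ with $\sigma_iv_m\le\kappa$ for all $i$, where $\sigma_i=\Delta t^n/\Delta x_i$, such that the inequality $$\eta(U_i^{n+1})+gz_ih_i^{n+1}\le\eta(U_i)+gz_ih_i-\sigma_i\bigl(\widetilde G_{i+1/2}-\widetilde G_{i-1/2}\bigr)$$ fails for some $i\in\mathbb Z$ with $h_i^{n+1}>0$, where $U_i^{n+1}$ is the update given by the scheme and $$\widetilde G_{i+1/2}=\mathcal G(U_{i+1/2-},U_{i+1/2+})+gz_{i+1/2}\mathcal F^0(U_{i+1/2-},U_{i+1/2+}),$$ with $\mathcal F^0$ the first component of $\mathcal F$.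
   Context: $g>0$ is a constant. For $U=(h,hu)^T$, $\eta(U)=h\frac{u^2}2+g\frac{h^2}2$ and $G(U)=\bigl(h\frac{u^2}2+gh^2\bigr)u$ are the entropy and entropy flux of the homogeneous Saint-Venant system $\partial_th+\partial_x(hu)=0$, $\partial_t(hu)+\partial_x(hu^2+gh^2/2)=0$. A numerical flux $\mathcal F(U_l,U_r)\in\mathbb R^2$ is consistent if $\mathcal F(U,U)=(hu,\,hu^2+gh^2/2)^T$, and a numerical entropy flux $\mathcal G(U_l,U_r)\in\mathbb R$ is consistent if $\mathcal G(U,U)=G(U)$. Hydrostatic reconstruction scheme: with $x_+=\max(0,x)$, $z_{i+1/2}=\max(z_i,z_{i+1})$, $h_{i+1/2-}=(h_i+z_i-z_{i+1/2})_+$, $h_{i+1/2+}=(h_{i+1}+z_{i+1}-z_{i+1/2})_+$, $U_{i+1/2-}=(h_{i+1/2-},h_{i+1/2-}u_i)^T$, $U_{i+1/2+}=(h_{i+1/2+},h_{i+1/2+}u_{i+1})^T$, the update is $U_i^{n+1}=U_i-\sigma_i(F_{i+1/2-}-F_{i-1/2+})$, with first component $h_i^{n+1}$, where $$F_{i+1/2-}=\mathcal F(U_{i+1/2-},U_{i+1/2+})+\begin{pmatrix}0\\ \frac{gh_i^2}2-\frac{gh_{i+1/2-}^2}2\end{pmatrix},\quad F_{i+1/2+}=\mathcal F(U_{i+1/2-},U_{i+1/2+})+\begin{pmatrix}0\\ \frac{gh_{i+1}^2}2-\frac{gh_{i+1/2+}^2}2\end{pmatrix}.$$ *)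

(* Defs.v *)
From mathcomp Require Import all_boot all_order all_algebra.
From mathcomp Require Import reals.

Set Implicit Arguments.
Unset Strict Implicit.
Unset Printing Implicit Defensive.

Import Order.TTheory GRing.Theory Num.Theory.

Local Open Scope ring_scope.

Definition vec2 (R : realType) (a b : R) : 'cV[R]_2 :=
  \col_(k < 2) (if k == 0 then a else b).

(* The conservative state (h, h u)^T *)
Definition state (R : realType) (h u : R) : 'cV[R]_2 := vec2 h (h * u).

Definition height (R : realType) (U : 'cV[R]_2) : R := U 0 0.

(* Since 0^-1 = 0, the velocity of the dry state (0, 0) is 0; every use below
   multiplies the velocity by the water height. *)
Definition velocity (R : realType) (U : 'cV[R]_2) : R := U 1 0 / U 0 0.

Definition sv_flux (R : realType) (g : R) (U : 'cV[R]_2) : 'cV[R]_2 :=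
  let h := height U in let u := velocity U in
  vec2 (h * u) (h * u ^+ 2 + g * h ^+ 2 / 2).

Definition entropy (R : realType) (g : R) (U : 'cV[R]_2) : R :=
  let h := height U in let u := velocity U in
  h * (u ^+ 2 / 2) + g * (h ^+ 2 / 2).

Definition entropy_flux (R : realType) (g : R) (U : 'cV[R]_2) : R :=
  let h := height U in let u := velocity U in
  (h * (u ^+ 2 / 2) + g * h ^+ 2) * u.

(* Numerical fluxes are total functions on pairs of vectors, but consistency
   constrains them only on the physical states (h, h u) with h >= 0. *)
Definition consistent_flux (R : realType) (g : R)
    (F : 'cV[R]_2 -> 'cV[R]_2 -> 'cV[R]_2) : Prop :=
  forall h u : R, 0 <= h -> F (state h u) (state h u) = sv_flux g (state h u).

Definition consistent_entropy_flux (R : realType) (g : R)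
    (G : 'cV[R]_2 -> 'cV[R]_2 -> R) : Prop :=
  forall h u : R, 0 <= h ->
    G (state h u) (state h u) = entropy_flux g (state h u).

(* Below, the interface i+1/2 is indexed by i, so that i-1/2 is i - 1; the
   suffixes L and R stand for the subscripts i+1/2- and i+1/2+. *)

Definition z_half (R : realType) (z : int -> R) (i : int) : R :=
  Num.max (z i) (z (i + 1)).

Definition hL (R : realType) (h z : int -> R) (i : int) : R :=
  Num.max 0 (h i + z i - z_half z i).

Definition hR (R : realType) (h z : int -> R) (i : int) : R :=
  Num.max 0 (h (i + 1) + z (i + 1) - z_half z i).

Definition UL (R : realType) (h u z : int -> R) (i : int) : 'cV[R]_2 :=
  state (hL h z i) (u i).

Definition UR (R : realType) (h u z : int -> R) (i : int) : 'cV[R]_2 :=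
  state (hR h z i) (u (i + 1)).

Definition FL (R : realType) (g : R) (F : 'cV[R]_2 -> 'cV[R]_2 -> 'cV[R]_2)
    (h u z : int -> R) (i : int) : 'cV[R]_2 :=
  F (UL h u z i) (UR h u z i)
  + vec2 0 (g * h i ^+ 2 / 2 - g * hL h z i ^+ 2 / 2).

Definition FR (R : realType) (g : R) (F : 'cV[R]_2 -> 'cV[R]_2 -> 'cV[R]_2)
    (h u z : int -> R) (i : int) : 'cV[R]_2 :=
  F (UL h u z i) (UR h u z i)
  + vec2 0 (g * h (i + 1) ^+ 2 / 2 - g * hR h z i ^+ 2 / 2).

Definition hr_update (R : realType) (g : R)
    (F : 'cV[R]_2 -> 'cV[R]_2 -> 'cV[R]_2)
    (h u z sigma : int -> R) (i : int) : 'cV[R]_2 :=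
  state (h i) (u i) - sigma i *: (FL g F h u z i - FR g F h u z (i - 1)).

Definition Gtilde (R : realType) (g : R)
    (F : 'cV[R]_2 -> 'cV[R]_2 -> 'cV[R]_2) (G : 'cV[R]_2 -> 'cV[R]_2 -> R)
    (h u z : int -> R) (i : int) : R :=
  G (UL h u z i) (UR h u z i)
  + g * z_half z i * F (UL h u z i) (UR h u z i) 0 0.

Definition discrete_entropy_inequality (R : realType) (g : R)
    (F : 'cV[R]_2 -> 'cV[R]_2 -> 'cV[R]_2) (G : 'cV[R]_2 -> 'cV[R]_2 -> R)
    (h u z sigma : int -> R) (i : int) : Prop :=
  let U' := hr_update g F h u z sigma i in
  entropy g U' + g * z i * height U' <=
  entropy g (state (h i) (u i)) + g * z i * h i
  - sigma i * (Gtilde g F G h u z i - Gtilde g F G h u z (i - 1)).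

(* Main.v *)
Require Import Defs.
From mathcomp Require Import all_boot all_order all_algebra.
From mathcomp Require Import reals.
From mathcomp Require Import ring lra.

Import Order.TTheory GRing.Theory Num.Theory.

Local Open Scope ring_scope.

(** A consistent flux is known only on pairs of equal states, so the
    counterexample must make the two reconstructed states agree at every
    interface.  This happens for a flat free surface [h i + z i = H] moving with
    a uniform velocity [c]: at each interface both reconstructed states are
    [state (H - z_half z i) c].  On such data the hydrostatic reconstruction
    transports mass and momentum with the same velocity, hence keeps the velocity
    [c] ([hr_update_flat_surface]).  The kinetic energy is then balanced exactly
    by its flux, and what remains is the potential energy
    [g h^2 / 2 + g z h], whose derivative in [h] is [g (h + z) = g H]: the
    numerical entropy flux accounts for the first order variation
    [g H (h' - h)], and the scheme produces exactly the second order term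
    [g (h' - h)^2 / 2] of the Taylor expansion
    ([discrete_entropy_inequality_flat_surface]).

    This term is positive as soon as the water height changes, whatever the size
    of the time step.  A topography with a single bump next to the cell under
    consideration makes the two interface heights of this cell different, and so
    the height changes. *)

Section States.
#[local] Set Implicit Arguments.
#[local] Unset Strict Implicit.
Variable R : realType.
Implicit Types a b g h u : R.

Lemma vec2_0 a b : vec2 a b 0 0 = a.
Proof. by rewrite mxE. Qed.

Lemma vec2_1 a b : vec2 a b 1 0 = b.
Proof. by rewrite mxE. Qed.

Lemma height_state h u : height (state h u) = h.
Proof. exact: vec2_0. Qed.

Lemma velocity_state h u : h != 0 -> velocity (state h u) = u.
Proof. by move=> h0; rewrite /velocity vec2_0 vec2_1 [h * u]mulrC mulfK. Qed.

(** The velocity of a dry state is lost, but it enters the three physical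
    functions only through terms with a factor [h]; this is why the next three
    formulas hold for every [h]. *)
Lemma sv_flux_state g h u :
  sv_flux g (state h u) = vec2 (h * u) (h * u ^+ 2 + g * h ^+ 2 / 2).
Proof.
rewrite /sv_flux height_state; have [->|h0] := eqVneq h 0.
  by rewrite !mul0r.
by rewrite velocity_state.
Qed.

Lemma entropy_state g h u :
  entropy g (state h u) = h * (u ^+ 2 / 2) + g * (h ^+ 2 / 2).
Proof.
rewrite /entropy height_state; have [->|h0] := eqVneq h 0.
  by rewrite !mul0r.
by rewrite velocity_state.
Qed.

Lemma entropy_flux_state g h u :
  entropy_flux g (state h u) = (h * (u ^+ 2 / 2) + g * h ^+ 2) * u.
Proof.
rewrite /entropy_flux height_state; have [->|h0] := eqVneq h 0.
  by rewrite expr0n /= !(mul0r, mulr0, addr0).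
by rewrite velocity_state.
Qed.

End States.

Section FlatSurface.
#[local] Set Implicit Arguments.
#[local] Unset Strict Implicit.
Variables (R : realType) (g : R).
Variables (F : 'cV[R]_2 -> 'cV[R]_2 -> 'cV[R]_2) (G : 'cV[R]_2 -> 'cV[R]_2 -> R).
Hypotheses (hF : consistent_flux g F) (hG : consistent_entropy_flux g G).
Variables (z sigma : int -> R) (H c : R).
Hypothesis zH : forall i, z i <= H.

Let h (i : int) : R := H - z i.
Let u (_ : int) : R := c.

Let interface_height (i : int) : R := H - z_half z i.

Lemma interface_height_ge0 i : 0 <= interface_height i.
Proof. by rewrite subr_ge0 ge_max !zH. Qed.

Lemma hL_flat_surface i : hL h z i = interface_height i.
Proof.
by rewrite /hL subrK; apply/max_idPr; exact: interface_height_ge0.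
Qed.

Lemma hR_flat_surface i : hR h z i = interface_height i.
Proof.
by rewrite /hR subrK; apply/max_idPr; exact: interface_height_ge0.
Qed.

Lemma numerical_flux_flat_surface i :
  F (UL h u z i) (UR h u z i) = sv_flux g (state (interface_height i) c).
Proof.
rewrite /UL /UR hL_flat_surface hR_flat_surface.
exact: hF (interface_height_ge0 i).
Qed.

Let new_height (i : int) : R :=
  h i - sigma i * c * (interface_height i - interface_height (i - 1)).

(** The corrections to the momentum flux replace the interface pressure
    [g h_{i+1/2}^2 / 2] by the cell pressure [g h_i^2 / 2], the same on both
    sides of the cell; so only the transport terms remain, and the momentum flux
    is [c] times the mass flux. *)
Lemma hr_update_flat_surface i :
  hr_update g F h u z sigma i = state (new_height i) c.
Proof.
rewrite /hr_update /FL /FR !numerical_flux_flat_surface.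
rewrite hL_flat_surface hR_flat_surface !sv_flux_state subrK /new_height.
apply/matrixP => k l; rewrite !mxE.
by case: ifP => _; rewrite /u; field.
Qed.

Lemma Gtilde_flat_surface i :
  Gtilde g F G h u z i =
    (c ^+ 2 / 2 + g * H) * (interface_height i * c).
Proof.
rewrite /Gtilde numerical_flux_flat_surface sv_flux_state vec2_0.
rewrite /UL /UR hL_flat_surface hR_flat_surface.
rewrite (hG _ (interface_height_ge0 i)) entropy_flux_state.
have -> : z_half z i = H - interface_height i by rewrite opprB addrC subrK.
by rewrite /u; field.
Qed.

(** With [h'] the updated height, the two sides of the entropy inequality differ
    by [g (h'^2 - h^2) / 2 + g (z - H) (h' - h) = g (h' - h)^2 / 2], because
    [H - z = h]. *)
Lemma discrete_entropy_inequality_flat_surface i :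
  discrete_entropy_inequality g F G h u z sigma i <->
  g / 2 * (new_height i - h i) ^+ 2 <= 0.
Proof.
rewrite /discrete_entropy_inequality hr_update_flat_surface height_state.
rewrite !Gtilde_flat_surface !entropy_state.
rewrite -subr_le0; set d := (X in X <= 0).
suff -> : d = g / 2 * (new_height i - h i) ^+ 2 by [].
by rewrite /d /new_height /h /u; field.
Qed.

Lemma height_hr_update_flat_surface i :
  height (hr_update g F h u z sigma i) =
  h i - sigma i * c * (z_half z (i - 1) - z_half z i).
Proof.
rewrite hr_update_flat_surface height_state /new_height /interface_height.
by ring.
Qed.

(** The hypotheses say that the mass fluxes through the two sides of the cell
    differ, so that its height changes and the quadratic defect is positive. *)
Lemma entropy_inequality_fails_flat_surface i :
  0 < g -> sigma i * c != 0 -> z_half z i != z_half z (i - 1) ->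
  ~ discrete_entropy_inequality g F G h u z sigma i.
Proof.
move=> g0 sc0 zz /discrete_entropy_inequality_flat_surface.
apply/negP; rewrite -ltNge mulr_gt0 ?divr_gt0 //.
rewrite lt0r sqr_ge0 andbT expf_eq0 /= /new_height addrC addKr oppr_eq0.
by rewrite mulf_neq0 // subr_eq0 (inj_eq (subrI H)).
Qed.

End FlatSurface.

Section Bump.
Variable R : realType.

Definition bump (i : int) : R := (i == 1)%:R.

Lemma bump_ge0 i : 0 <= bump i.
Proof. exact: ler0n. Qed.

Lemma bump_le1 i : bump i <= 1.
Proof. by rewrite /bump lern1 leq_b1. Qed.

Lemma z_half_bump_right : z_half bump 0 = 1.
Proof. by rewrite /z_half /bump /=; apply/max_idPr; exact: ler01. Qed.

Lemma z_half_bump_left : z_half bump (0 - 1) = 0.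
Proof. by rewrite /z_half /bump /= maxxx. Qed.

End Bump.

Theorem proposition3p8 (R : realType) (g : R) (hg : 0 < g)
    (F : 'cV[R]_2 -> 'cV[R]_2 -> 'cV[R]_2) (G : 'cV[R]_2 -> 'cV[R]_2 -> R)
    (hF : consistent_flux g F) (hG : consistent_entropy_flux g G) :
  forall kappa : R, 0 < kappa ->
  exists (h u z : int -> R) (vm dt : R) (dx : int -> R),
    let sigma := fun i : int => dt / dx i in
    (forall i, 0 <= h i) /\
    0 <= vm /\
    (forall i, `|u i| + Num.sqrt (2 * g * h i) <= vm) /\
    0 < dt /\
    (forall i, 0 < dx i) /\
    (forall i, sigma i * vm <= kappa) /\
    exists i : int,
      0 < height (hr_update g F h u z sigma i) /\
      ~ discrete_entropy_inequality g F G h u z sigma i.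
Proof.
move=> kappa k0.
(* The surface level 2 keeps the bump of height 1 under water. *)
have zH i : bump R i <= 2 by have := bump_le1 R i; lra.
pose vm : R := 1 + Num.sqrt (2 * g * 2).
have vm0 : 0 < vm by rewrite ltr_wpDr ?sqrtr_ge0.
have s0 : 0 < kappa / vm by rewrite divr_gt0.
exists (fun i => 2 - bump R i), (fun=> 1), (bump R), vm, (kappa / vm), (fun=> 1).
rewrite /=; split; first by move=> i; rewrite subr_ge0.
split; first exact: ltW.
split.
  move=> i; rewrite normr1 lerD2l ler_wsqrtr // ler_wpM2l //.
    by rewrite mulr_ge0 // ltW.
  by rewrite gerBl bump_ge0.
split=> //; split; first by move=> _; exact: ltr01.
split; first by move=> _; rewrite divr1 divfK ?gt_eqF.
(* Cell 0 has the bump on its right only: its interface heights are 2 and 1. *)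
exists 0; split.
  rewrite (height_hr_update_flat_surface hF _ _ zH) z_half_bump_left z_half_bump_right.
  have := bump_le1 R 0; rewrite divr1; lra.
apply: (entropy_inequality_fails_flat_surface hF hG zH) => //.
  by rewrite divr1 mulr1 gt_eqF.
by rewrite z_half_bump_left z_half_bump_right oner_eq0.
Qed.
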